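(* For any $N\in\mathbb{N}$, $\mathbb{R}\times\{0,\dots,N\}$ is a unique expansion set. In particular, for any subset $D$ of $\mathbb{R}$, $D\times\{0,\dots,N\}$ is a unique expansion set.
   Context: $\mathbb{N}=\{0,1,2,\dots\}$, $\mathbb{C}^\times=\mathbb{C}\setminus\{0\}$. For $z\in\mathbb{C}^\times$, $\log z=\log|z|+i\arg z$ with $0\le\arg z<2\pi$, and $z^\alpha=e^{\alpha\log z}$ for $\alpha\in\mathbb{C}$. A subset $\mathcal{S}\subset\mathbb{C}\times\mathbb{C}$ is called a unique expansion set if the absolute convergence to $0$ on some nonempty open subset of $\mathbb{C}^\times$ of any series $\sum_{(\alpha,\beta)\in\mathcal{S}}a_{\alpha,\beta}z^\alpha(\log z)^\beta$, $a_{\alpha,\beta}\in\mathbb{C}$, implies that $a_{\alpha,\beta}=0$ for all $(\alpha,\beta)\in\mathcal{S}$. *)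

(* Defs.v *)
From HB Require Import structures.
From mathcomp Require Import all_boot all_order all_algebra finmap complex.
From mathcomp Require Import all_classical all_reals all_analysis.
From mathcomp.analysis Require Import summability.

Set Implicit Arguments.
Unset Strict Implicit.
Unset Printing Implicit Defensive.

Import Order.TTheory GRing.Theory Num.Theory.
Import numFieldNormedType.Exports.

Local Open Scope classical_set_scope.
Local Open Scope ring_scope.
Local Open Scope complex_scope.

(* The complex modulus with values in R; `|z| in R[i] is (cmod z)%:C. *)
Notation cmod := ComplexField.Normc.normc.

Definition cexp (R : realType) (z : R[i]) : R[i] :=
  (expR (complex.Re z))%:C * (cos (complex.Im z) +i* sin (complex.Im z)).

(* Meaningful for z != 0 only, where such a t exists and is unique. *)
Definition carg (R : realType) (z : R[i]) : R :=
  get [set t : R | 0 <= t < 2 * pi /\ z = (cmod z)%:C * (cos t +i* sin t)].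

Definition clog (R : realType) (z : R[i]) : R[i] := ln (cmod z) +i* carg z.

(* For z != 0 this is e^(alpha log z).  The value at z = 0 is needed because
   log z itself is raised to a power and log 1 = 0; the convention there is the
   one of powR, which agrees with ordinary powers for alpha in nat. *)
Definition cpow (R : realType) (z alpha : R[i]) : R[i] :=
  if z == 0 then (alpha == 0)%:R else cexp (alpha * clog z).

Definition expansion_term (R : realType) (a : R[i] * R[i] -> R[i]) (z : R[i])
    (p : R[i] * R[i]) : R[i] :=
  a p * cpow z p.1 * cpow (clog z) p.2.

(* S may be uncountable: absolute convergence is summability of the moduli,
   and the sum is the limit of the finite partial sums along the directed set
   of finite sets of indices, the terms outside S being replaced by 0.
   The topology of the complex plane is the one of R[i]^o. *)
Definition abs_converges_to (R : realType) (I : choiceType) (S : set I)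
    (f : I -> R[i]) (l : R[i]) : Prop :=
  esum.summable S (fun i => (cmod (f i))%:E) /\
  partial_sum (fun i => if i \in S then f i else 0) A @[A --> totally]
    --> (l : R[i]^o).

Definition unique_expansion_set (R : realType) (S : set (R[i] * R[i])) : Prop :=
  forall a : R[i] * R[i] -> R[i],
    (exists U : set R[i]^o,
      [/\ open U, U !=set0, (forall z, U z -> z != 0) &
          forall z, U z -> abs_converges_to S (expansion_term a z) 0]) ->
    forall p, S p -> a p = 0.

Definition complex_reals (R : realType) (D : set R) : set R[i] :=
  [set x%:C | x in D].

Definition complex_nats_upto (R : realType) (N : nat) : set R[i] :=
  [set k%:R | k in [set k : nat | (k <= N)%N]].

(* Main.v *)
(* Put w = log z = s + i x.  For fixed s the series becomes
   F(x) = sum_k w^k h_k(x), where h_k(x) = sum_p b_k(p) e^{i al_p x} and, because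
   the original series converges absolutely for nearby values of s, even
   sum_p |b_k(p)| e^{|al_p| d} is finite for some d > 0.  Hence F has at every real
   point a Taylor expansion valid within the same distance d, and the vanishing
   of F on an interval propagates to a half-line.  Letting x tend to infinity in
   F = 0 shows that the h_k of highest index tends to 0 at infinity; an
   absolutely convergent trigonometric sum with this property has zero
   coefficients, and one descends on k. *)
Require Import Defs.
From mathcomp Require Import all_boot all_order all_algebra finmap complex.
From mathcomp Require Import all_classical all_reals all_analysis.
From mathcomp.analysis Require Import summability.
From mathcomp Require Import ring lra.

Set Implicit Arguments.
Unset Strict Implicit.
Unset Printing Implicit Defensive.

Import Order.TTheory GRing.Theory Num.Theory.
Import numFieldNormedType.Exports.

Local Open Scope classical_set_scope.
Local Open Scope ring_scope.
Local Open Scope complex_scope.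

(** * The real-valued complex modulus *)

Section Modulus.
Variable R : realType.
Implicit Types x y : R[i].

Lemma cmod_norm x : (cmod x)%:C = `|x|.
Proof. by []. Qed.

Lemma cmod_ge0 x : 0 <= cmod x.
Proof. by case: x => a b; exact: sqrtr_ge0. Qed.

Lemma cmodD x y : cmod (x + y) <= cmod x + cmod y.
Proof. exact: (le_normcD (x : Rcomplex R) y). Qed.

Lemma cmodN x : cmod (- x) = cmod x.
Proof. exact: (normcN (x : Rcomplex R)). Qed.

Lemma cmodB x y : cmod (x - y) <= cmod x + cmod y.
Proof. by rewrite -(cmodN y); exact: cmodD. Qed.

Lemma cmodM x y : cmod (x * y) = cmod x * cmod y.
Proof. exact: ComplexField.Normc.normcM. Qed.

Lemma cmod0 : cmod (0 : R[i]) = 0.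
Proof. exact: ComplexField.Normc.normc0. Qed.

Lemma cmod1 : cmod (1 : R[i]) = 1.
Proof. exact: ComplexField.Normc.normc1. Qed.

Lemma cmod_i : cmod ('i : R[i]) = 1.
Proof.
by rewrite /ComplexField.Normc.normc expr0n add0r expr1n sqrtr1.
Qed.

Lemma cmodX x n : cmod (x ^+ n) = cmod x ^+ n.
Proof. by elim: n => [|n IH]; rewrite ?expr0 ?cmod1// !exprS cmodM IH. Qed.

Lemma cmod_real (r : R) : cmod r%:C = `|r|.
Proof. by rewrite /ComplexField.Normc.normc /= expr0n addr0 sqrtr_sqr. Qed.

Lemma cmod_sum (I : Type) (s : seq I) (P : pred I) (f : I -> R[i]) :
  cmod (\sum_(i <- s | P i) f i) <= \sum_(i <- s | P i) cmod (f i).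
Proof.
elim/big_rec2: _ => [|i u v _ uv]; first by rewrite cmod0.
by rewrite (le_trans (cmodD _ _))// lerD2l.
Qed.

Lemma cmod_eq0 x : (cmod x == 0) = (x == 0).
Proof.
apply/eqP/eqP => [|->]; [exact: ComplexField.Normc.eq0_normc|exact: cmod0].
Qed.

Lemma cmod_le_small x : (forall e : R, 0 < e -> cmod x <= e) -> x = 0.
Proof.
move=> H; apply/eqP; rewrite -cmod_eq0 eq_le cmod_ge0 andbT.
by apply/ler_addgt0Pr => e e0; rewrite add0r H.
Qed.

Lemma cmod_le_ReIm (a b : R) : cmod (a +i* b) <= `|a| + `|b|.
Proof.
have -> : a +i* b = a%:C + 'i * b%:C by simpc.
by rewrite (le_trans (cmodD _ _))// cmodM !cmod_real cmod_i mul1r.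
Qed.

Lemma ler_Re_cmod x : `|complex.Re x| <= cmod x.
Proof. by rewrite -lecR; exact: normc_ge_Re. Qed.

Lemma ler_Im_cmod x : `|complex.Im x| <= cmod x.
Proof.
case: x => a b /=; rewrite -[leLHS]sqrtr_sqr ler_wsqrtr// lerDr.
exact: sqr_ge0.
Qed.

End Modulus.

(** * Unconditional summation over an arbitrary index type *)

Section Unconditional.
Variables (R : realType) (I : choiceType).
Implicit Types (f g : I -> R[i]) (A B : {fset I}).

(** The epsilon form of convergence along the directed set of finite index sets, as in
    [abs_converges_to]. *)
Definition is_sum f (l : R[i]) : Prop := forall e : R, 0 < e ->
  exists A, forall B, (A `<=` B)%fset -> cmod (\sum_(i <- B) f i - l) <= e.

Definition abs_bounded f (K : R) : Prop :=
  forall A, \sum_(i <- A) cmod (f i) <= K.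

Lemma big_fset_sub (g : I -> R) A B : (A `<=` B)%fset ->
  \sum_(i <- B | i \in A) g i = \sum_(i <- A) g i.
Proof.
move=> AB; rewrite -big_filter; apply: perm_big.
apply: uniq_perm; rewrite ?filter_uniq ?fset_uniq// => i.
by rewrite mem_filter; apply/andP/idP => [[]//|iA]; split => //; exact: (fsubsetP AB).
Qed.

Lemma is_sum0 : is_sum (fun=> 0) 0.
Proof.
by move=> e e0; exists fset0 => B _; rewrite big1// subrr cmod0 ltW.
Qed.

Lemma is_sumD f g l m : is_sum f l -> is_sum g m ->
  is_sum (fun i => f i + g i) (l + m).
Proof.
move=> fl gm e e0; have e2 : 0 < e / 2 by rewrite divr_gt0.
have [A HA] := fl _ e2; have [A' HA'] := gm _ e2.
exists (A `|` A')%fset => B; rewrite fsubUset => /andP[AB A'B].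
rewrite big_split/= opprD addrACA (le_trans (cmodD _ _))//.
by rewrite [e]splitr lerD ?HA ?HA'.
Qed.

Lemma is_sumZ f l k : is_sum f l -> is_sum (fun i => k * f i) (k * l).
Proof.
move=> fl e e0; have e2 : 0 < e / (cmod k + 1).
  by rewrite divr_gt0// ltr_wpDl// cmod_ge0.
have [A HA] := fl _ e2; exists A => B /HA H.
rewrite -mulr_sumr -mulrBr cmodM.
have k1 : 0 < cmod k + 1 by rewrite ltr_wpDl// cmod_ge0.
rewrite ler_pdivlMr// in H; apply: le_trans H.
by rewrite mulrC ler_wpM2l ?cmod_ge0// lerDl.
Qed.

Lemma is_sum_sum n (f : nat -> I -> R[i]) (l : nat -> R[i]) :
  (forall k, (k < n)%N -> is_sum (f k) (l k)) ->
  is_sum (fun i => \sum_(k < n) f k i) (\sum_(k < n) l k).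
Proof.
elim: n => [_|n IH H].
  by rewrite big_ord0; under eq_fun do rewrite big_ord0; exact: is_sum0.
rewrite big_ord_recr/=; under eq_fun do rewrite big_ord_recr/=.
by apply: is_sumD; [apply: IH => k kn; apply: H; exact: ltnW|exact: H].
Qed.

(** Closed bounds pass to the limit, and partial sums need be controlled only beyond a chosen finite
    set; uniqueness of sums and tail estimates both use this freedom. *)
Lemma is_sum_cmodB_le f l c K A :
  is_sum f l ->
  (forall B, (A `<=` B)%fset -> cmod (\sum_(i <- B) f i - c) <= K) ->
  cmod (l - c) <= K.
Proof.
move=> fl H; apply/ler_addgt0Pr => e e0; have [A' HA'] := fl e e0.
have H1 := H (A `|` A')%fset (fsubsetUl _ _).
have H2 := HA' (A `|` A')%fset (fsubsetUr _ _).
rewrite -(subrKA (\sum_(i <- (A `|` A')%fset) f i)) addrC.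
rewrite (le_trans (cmodD _ _))// lerD//.
by rewrite -opprB cmodN.
Qed.

Lemma is_sum_cmod_le f l K : is_sum f l -> abs_bounded f K -> cmod l <= K.
Proof.
move=> fl fK; rewrite -[l]subr0; apply: (is_sum_cmodB_le (A := fset0) fl).
by move=> B _; rewrite subr0 (le_trans (cmod_sum _ _ _)).
Qed.

Lemma is_sum_inj f l m : is_sum f l -> is_sum f m -> l = m.
Proof.
move=> fl fm; apply/eqP; rewrite -subr_eq0; apply/eqP.
apply: cmod_le_small => e e0; have [A HA] := fm e e0.
exact: is_sum_cmodB_le fl HA.
Qed.

Lemma abs_bounded_le f g K : (forall i, cmod (f i) <= cmod (g i)) ->
  abs_bounded g K -> abs_bounded f K.
Proof. by move=> fg gK A; apply: le_trans (gK A); apply: ler_sum. Qed.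

Lemma is_sum_nneg_exists (g : I -> R) (K : R) : (forall i, 0 <= g i) ->
  (forall A, \sum_(i <- A) g i <= K) -> exists l : R, is_sum (fun i => (g i)%:C) l%:C.
Proof.
move=> g0 gK; pose S := [set \sum_(i <- A) g i | A in [set: {fset I}]].
have hS : has_sup S.
  split; first by exists (\sum_(i <- fset0) g i); exists fset0.
  by exists K => _ [A _ <-].
exists (sup S) => e e0; have [_ [A _ <-] HA] := sup_adherent e0 hS.
exists A => B AB; rewrite -rmorph_sum -rmorphB cmod_real ler_norml.
have BS : \sum_(i <- B) g i <= sup S by apply: (ub_le_sup hS.2); exists B.
have ABs : \sum_(i <- A) g i <= \sum_(i <- B) g i.
  by rewrite [leRHS](bigID (mem A))/= big_fset_sub// lerDl sumr_ge0.
by apply/andP; split; lra.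
Qed.

(** Write [g] as [(g + |g|) - |g|], a difference of nonnegative families with bounded partial
    sums. *)
Lemma is_sum_real_exists (g : I -> R) (K : R) :
  (forall A, \sum_(i <- A) `|g i| <= K) -> exists l : R, is_sum (fun i => (g i)%:C) l%:C.
Proof.
move=> gK.
have [l1 H1] : exists l : R, is_sum (fun i => (`|g i|)%:C) l%:C.
  exact: is_sum_nneg_exists gK.
have [l2 H2] : exists l : R, is_sum (fun i => (g i + `|g i|)%:C) l%:C.
  apply: (@is_sum_nneg_exists _ (K + K)) => [i|A].
    by rewrite addrC -[g i]opprK subr_ge0 normrN; exact: ler_norm.
  rewrite big_split/= lerD//; apply: le_trans (gK A).
  by apply: ler_sum => i _; exact: ler_norm.
exists (l2 - l1); have := is_sumD H2 (is_sumZ (-1) H1).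
rewrite mulN1r -rmorphB; congr is_sum; apply/funext => i.
by rewrite rmorphD mulN1r addrK.
Qed.

Lemma is_sum_exists f K : abs_bounded f K -> exists l, is_sum f l.
Proof.
move=> fK.
have [a Ha] : exists a : R, is_sum (fun i => (complex.Re (f i))%:C) a%:C.
  apply: (@is_sum_real_exists _ K) => A; apply: le_trans (fK A).
  by apply: ler_sum => i _; exact: ler_Re_cmod.
have [b Hb] : exists a : R, is_sum (fun i => (complex.Im (f i))%:C) a%:C.
  apply: (@is_sum_real_exists _ K) => A; apply: le_trans (fK A).
  by apply: ler_sum => i _; exact: ler_Im_cmod.
exists (a%:C + 'i * b%:C); have := is_sumD Ha (is_sumZ 'i Hb).
by congr is_sum; apply/funext => i; rewrite -complexE.
Qed.

(** Choose [A] with partial sum within [e] of the supremum; no larger set can then add more than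
    [e]. *)
Lemma abs_bounded_tail f K : abs_bounded f K -> forall e : R, 0 < e ->
  exists A, forall B, (A `<=` B)%fset ->
    \sum_(i <- B | i \notin A) cmod (f i) <= e.
Proof.
move=> fK e e0; pose S := [set \sum_(i <- A) cmod (f i) | A in [set: {fset I}]].
have hS : has_sup S.
  split; first by exists (\sum_(i <- fset0) cmod (f i)); exists fset0.
  by exists K => _ [A _ <-].
have [_ [A _ <-] HA] := sup_adherent e0 hS; exists A => B AB.
have BS : \sum_(i <- B) cmod (f i) <= sup S by apply: (ub_le_sup hS.2); exists B.
move: BS; rewrite (bigID (mem A))/= big_fset_sub//.
by move=> BS; lra.
Qed.

End Unconditional.

(** * The function [cis] and its Taylor remainders *)

Section Cis.
Variable R : realType.
Implicit Types x y : R.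

Definition cis x : R[i] := cos x +i* sin x.

Lemma cis0 : cis 0 = 1.
Proof. by rewrite /cis cos0 sin0. Qed.

Lemma cisD x y : cis (x + y) = cis x * cis y.
Proof. by rewrite /cis; simpc; rewrite cosD sinD addrC [X in _ +i* X]addrC. Qed.

Lemma cmod_cis x : cmod (cis x) = 1.
Proof. by rewrite /ComplexField.Normc.normc /= cos2Dsin2 sqrtr1. Qed.

Lemma cis_pi : cis pi = -1.
Proof. by rewrite /cis cospi sinpi; apply/eqP; rewrite eq_complex /= oppr0 !eqxx. Qed.

Lemma cis_coeff x n : ('i * x%:C) ^+ n / n`!%:R = cos_coeff x n +i* sin_coeff x n.
Proof.
rewrite exprMn /cos_coeff /sin_coeff /= -[n in 'i ^+ n]odd_double_half.
rewrite exprD -mul2n exprM sqr_i -rmorphXn -!mulrA.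
have -> : (n`!%:R : R[i])^-1 = ((n`!%:R : R)^-1)%:C by rewrite fmorphV rmorph_nat.
have -> : (-1 : R[i]) ^+ n./2 = ((-1 : R) ^+ n./2)%:C.
  by rewrite rmorphXn rmorphN1.
rewrite -!rmorphM; case: n => [|n]; first by rewrite /= expr0 !mul1r mul0r.
rewrite [n.+1.-1]/= [odd _]/=; case: (boolP (odd n)) => on /=.
  by rewrite expr0 !mul1r mul0r.
by rewrite expr1 mul0r mul1r uphalf_half (negbTE on); simpc.
Qed.

(** A Cauchy-type estimate: one constant [M] serves all orders [n], so the expansion converges to
    [f] for [|t| < d], and such bounds can be added over a family with common [d]. *)
Definition taylor_bound (f : R -> R[i]) (d M : R) (c : nat -> R[i]) : Prop :=
  forall n t, `|t| <= d ->
    cmod (f t - \sum_(m < n) c m * t%:C ^+ m) <= M * (`|t| / d) ^+ n.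

Lemma cis_coeff_sum x n : \sum_(m < n) ('i * x%:C) ^+ m / m`!%:R =
  series (cos_coeff x) n +i* series (sin_coeff x) n.
Proof.
rewrite /series /= !big_mkord; elim: n => [|n IH]; first by rewrite !big_ord0.
by rewrite !big_ord_recr/= IH cis_coeff; simpc.
Qed.

Lemma cmod_le_shift (a b : R[i]) (K : R) : (forall e : R, 0 < e ->
  exists2 z, cmod (a - z) <= e & cmod (z - b) <= K) -> cmod (a - b) <= K.
Proof.
move=> H; apply/ler_addgt0Pr => e /H[z az zb].
by rewrite -(subrKA z) (le_trans (cmodD _ _))// [K + e]addrC lerD.
Qed.

(** The m-th term has modulus [(|t| / d)^m (|a| d)^m / m!]. For [m >= n] the first factor is at most
    [(|t| / d)^n], and the rest sums to at most [expR (|a| d)]. *)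
Lemma cis_taylor (a d : R) : 0 < d ->
  taylor_bound (fun t => cis (a * t)) d (expR (`|a| * d))
    (fun m => ('i * a%:C) ^+ m / m`!%:R).
Proof.
move=> d0 n t td.
under eq_bigr => m _ do rewrite mulrAC -exprMn -mulrA -rmorphM/=.
set x := a * t; apply: cmod_le_shift.
move=> e e0; have e2 : 0 < e / 2 by rewrite divr_gt0.
have C : series (cos_coeff x) @ \oo --> cos x.
  by rewrite cos.unlock; exact: is_cvg_series_cos_coeff.
have S : series (sin_coeff x) @ \oo --> sin x.
  by rewrite sin.unlock; exact: is_cvg_series_sin_coeff.
have /cvgrPdist_le/(_ _ e2)[N1 _ H1] := C.
have /cvgrPdist_le/(_ _ e2)[N2 _ H2] := S.
(* A partial sum long enough to approximate both cosine and sine and to contain the first [n] terms;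
   the estimate concerns the terms from [n] to [p]. *)
pose p := maxn n (maxn N1 N2).
have np : (n <= p)%N by rewrite leq_max leqnn.
exists (\sum_(m < p) ('i * x%:C) ^+ m / m`!%:R).
  rewrite cis_coeff_sum /cis; simpc; rewrite (le_trans (cmod_le_ReIm _ _))//.
  by rewrite [e]splitr lerD// ?H1 ?H2//= !leq_max leqnn ?orbT.
rewrite -!(big_mkord xpredT (fun m => ('i * x%:C) ^+ m / m`!%:R)).
rewrite (big_cat_nat _ np)//= addrAC subrr add0r.
rewrite (le_trans (cmod_sum _ _ _))//.
have -> : expR (`|a| * d) * (`|t| / d) ^+ n = (`|t| / d) ^+ n * expR (`|a| * d).
  by rewrite mulrC.
have r0 : 0 <= `|t| / d by rewrite divr_ge0// ltW.
have ad0 : 0 <= `|a| * d by rewrite mulr_ge0// ltW.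
have r1 : `|t| / d <= 1 by rewrite ler_pdivrMr// mul1r.
apply: (@le_trans _ _ (\sum_(n <= m < p) (`|t| / d) ^+ n * exp_coeff (`|a| * d) m)).
  apply: ler_sum_nat => m /andP[nm _].
  rewrite cmodM cmodX cmodM cmod_i mul1r cmod_real /x normrM /exp_coeff [leRHS]mulrA.
  have -> : cmod (m`!%:R : R[i])^-1 = (m`!%:R : R)^-1.
    have -> : (m`!%:R : R[i])^-1 = ((m`!%:R : R)^-1)%:C.
      by rewrite fmorphV rmorph_nat.
    by rewrite cmod_real ger0_norm// invr_ge0.
  rewrite ler_wpM2r ?invr_ge0//.
  have -> : `|a| * `|t| = (`|t| / d) * (`|a| * d).
    by rewrite mulrCA -mulrA mulVf ?gt_eqF// mulr1.
  rewrite exprMn ler_wpM2r ?exprn_ge0//.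
  exact: ler_wiXn2l.
rewrite -mulr_sumr ler_wpM2l ?exprn_ge0//.
apply: (@le_trans _ _ (series (exp_coeff (`|a| * d)) p)).
  rewrite /series /= [leRHS](big_cat_nat _ np)//= lerDr sumr_ge0// => m _.
  exact: exp_coeff_ge0.
apply: nondecreasing_cvgn_le; last exact: is_cvg_series_exp_coeff.
apply/nondecreasing_seqP => k; rewrite /series/= big_nat_recr//= lerDl.
exact: exp_coeff_ge0.
Qed.

End Cis.

(** * Functions with a Taylor expansion of given radius *)

Section Taylor.
Variable R : realType.
Implicit Types (f g F : R -> R[i]) (d : R).

Definition has_taylor f d : Prop := exists M c, taylor_bound f d M c.

Lemma taylor_bound_ge0 f d M c : 0 < d -> taylor_bound f d M c -> 0 <= M.
Proof.
move=> d0 /(_ 0%N 0); rewrite normr0 expr0 mulr1 => H.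
by apply: le_trans (H (ltW d0)); exact: cmod_ge0.
Qed.

Lemma has_taylorD f g d : has_taylor f d -> has_taylor g d ->
  has_taylor (fun t => f t + g t) d.
Proof.
move=> [M [c H]] [M' [c' H']]; exists (M + M'), (fun m => c m + c' m) => n t td.
under eq_bigr do rewrite mulrDl.
by rewrite big_split/= opprD addrACA (le_trans (cmodD _ _))// mulrDl lerD ?H ?H'.
Qed.

Lemma has_taylor0 d : has_taylor (fun=> 0) d.
Proof.
exists 0, (fun=> 0) => n t td.
by rewrite big1 ?subrr ?cmod0 ?mul0r// => i _; rewrite mul0r.
Qed.

Lemma has_taylor_sum n (f : nat -> R -> R[i]) d :
  (forall k, (k < n)%N -> has_taylor (f k) d) ->
  has_taylor (fun t => \sum_(k < n) f k t) d.
Proof.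
elim: n => [_|n IH H].
  by under eq_fun do rewrite big_ord0; exact: has_taylor0.
under eq_fun do rewrite big_ord_recr/=.
by apply: has_taylorD; [apply: IH => k kn; apply: H; exact: ltnW|exact: H].
Qed.

(** The remainder of order [n + 1] is [u] times that of [f] of order [n + 1] plus [v t] times that
    of order [n]; the factor [|t| = d (|t| / d)] supplies the missing power. *)
Lemma has_taylor_mul_affine f d (u v : R[i]) : 0 < d -> has_taylor f d ->
  has_taylor (fun t => (u + v * t%:C) * f t) d.
Proof.
move=> d0 [M [c H]]; have M0 := taylor_bound_ge0 d0 H.
exists ((cmod u + cmod v * d) * M),
  (fun m => u * c m + v * (if m is m'.+1 then c m' else 0)) => -[|n] t td.
  rewrite big_ord0 subr0 cmodM expr0 mulr1 ler_pM ?cmod_ge0//.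
    rewrite (le_trans (cmodD _ _))// cmodM cmod_real lerD2l.
    by rewrite ler_wpM2l ?cmod_ge0.
  by have := H 0%N t td; rewrite big_ord0 subr0 expr0 mulr1.
set r := `|t| / d.
have tr : `|t| = d * r by rewrite /r mulrCA mulfV ?mulr1 ?gt_eqF.
have -> : \sum_(m < n.+1) (u * c m + v * (if m : nat is m'.+1 then c m' else 0)) *
    t%:C ^+ m = u * (\sum_(m < n.+1) c m * t%:C ^+ m) +
    v * t%:C * (\sum_(m < n) c m * t%:C ^+ m).
  under eq_bigr do rewrite mulrDl -mulrA.
  rewrite big_split/= -mulr_sumr; congr (_ + _).
  rewrite big_ord_recl/= mulr0 mul0r add0r mulr_sumr; apply: eq_bigr => i _.
  by rewrite /bump leq0n add1n exprS; ring.
have -> : (u + v * t%:C) * f t - (u * (\sum_(m < n.+1) c m * t%:C ^+ m) +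
    v * t%:C * (\sum_(m < n) c m * t%:C ^+ m)) =
    u * (f t - \sum_(m < n.+1) c m * t%:C ^+ m) +
    v * t%:C * (f t - \sum_(m < n) c m * t%:C ^+ m) by ring.
rewrite (le_trans (cmodD _ _))// !cmodM cmod_real.
have -> : (cmod u + cmod v * d) * M * r ^+ n.+1 =
    cmod u * (M * r ^+ n.+1) + cmod v * `|t| * (M * r ^+ n).
  by rewrite tr exprS; ring.
by rewrite lerD// ler_wpM2l ?mulr_ge0 ?cmod_ge0 ?H.
Qed.

Lemma has_taylor_mul_affineX f d (u v : R[i]) k : 0 < d -> has_taylor f d ->
  has_taylor (fun t => (u + v * t%:C) ^+ k * f t) d.
Proof.
move=> d0 ft; elim: k => [|k IH]; first by under eq_fun do rewrite expr0 mul1r.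
under eq_fun do rewrite exprS -mulrA.
exact: has_taylor_mul_affine.
Qed.

(** At [t = d] two consecutive remainders differ by [c m * d ^ m], and each is at most [M]. *)
Lemma taylor_bound_coeff f d M c m : 0 < d -> taylor_bound f d M c ->
  cmod (c m) <= 2 / d ^+ m * M.
Proof.
move=> d0 H; rewrite mulrAC ler_pdivlMr ?exprn_gt0//.
have dd : `|d| <= d by rewrite ger0_norm// ltW.
have d1 : `|d| / d = 1 by rewrite ger0_norm ?divff ?gt_eqF// ltW.
have := H m d dd; have := H m.+1 d dd; rewrite d1 !expr1n !mulr1 => H1 H2.
have -> : d ^+ m = cmod (d%:C ^+ m) by rewrite cmodX cmod_real ger0_norm// ltW.
rewrite -cmodM.
have -> : c m * d%:C ^+ m = (f d - \sum_(j < m) c j * d%:C ^+ j) -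
    (f d - \sum_(j < m.+1) c j * d%:C ^+ j) by rewrite big_ord_recr/=; ring.
by rewrite (le_trans (cmodB _ _))//; lra.
Qed.

(** The coefficients of the sum are the sums of the coefficients, which converge by
    [taylor_bound_coeff]; the remainder bounds then add up to [K]. *)
Lemma has_taylor_is_sum (I : choiceType) (f : I -> R -> R[i]) (M : I -> R)
    (c : I -> nat -> R[i]) F d K : 0 < d ->
  (forall i, taylor_bound (f i) d (M i) (c i)) ->
  (forall A : {fset I}, \sum_(i <- A) M i <= K) ->
  (forall t, is_sum (fun i => f i t) (F t)) ->
  has_taylor F d.
Proof.
move=> d0 Hf MK HF.
have /choice[C HC] : forall m, exists l, is_sum (fun i => c i m) l.
  move=> m; apply: (@is_sum_exists _ _ _ (2 / d ^+ m * K)) => A.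
  apply: (@le_trans _ _ (\sum_(i <- A) 2 / d ^+ m * M i)).
    by apply: ler_sum => i _; exact: taylor_bound_coeff.
  by rewrite -mulr_sumr ler_wpM2l// divr_ge0// exprn_ge0// ltW.
exists K, C => n t td.
have H : is_sum (fun i => f i t - \sum_(m < n) c i m * t%:C ^+ m)
    (F t - \sum_(m < n) C m * t%:C ^+ m).
  rewrite -mulN1r; under eq_fun do rewrite -mulN1r.
  apply: is_sumD (HF t) (is_sumZ _ _).
  apply: (@is_sum_sum _ _ n (fun m i => c i m * t%:C ^+ m)
    (fun m => C m * t%:C ^+ m)) => m _.
  by under eq_fun do rewrite mulrC; rewrite mulrC; exact: is_sumZ.
apply: (is_sum_cmod_le H) => A.
apply: (@le_trans _ _ (\sum_(i <- A) M i * (`|t| / d) ^+ n)).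
  by apply: ler_sum => i _; exact: Hf.
by rewrite -mulr_suml ler_wpM2r// exprn_ge0// divr_ge0// ltW.
Qed.

(** An identity theorem: vanishing near 0 kills the coefficients one after another, and then
    [|F t| <= M (|t| / d)^n] for every [n]. *)
Lemma has_taylor_eq0 F d e : 0 < d -> 0 < e -> has_taylor F d ->
  (forall t, `|t| < e -> F t = 0) -> forall t, `|t| < d -> F t = 0.
Proof.
move=> d0 e0 [M [c H]] F0; have M0 := taylor_bound_ge0 d0 H.
have c0 : forall m, c m = 0.
  elim/ltn_ind => m IH; apply: cmod_le_small => s s0.
  pose K := M / d ^+ m.+1; have K0 : 0 <= K by rewrite divr_ge0// exprn_ge0// ltW.
  have K1 : 0 < K + 1 by rewrite ltr_wpDl.
  (* Once the lower coefficients vanish, the remainder of order [m + 1] gives [|c m| <= K t]. This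
     [t] lies in the zero interval and makes [K t <= s]; the [+ 1] guards against [K = 0]. *)
  pose t := Num.min (Num.min e d / 2) (s / (K + 1)).
  have t0 : 0 < t by rewrite lt_min !divr_gt0 ?lt_min ?e0.
  have tm : t <= Num.min e d / 2 by rewrite /t ge_min lexx.
  have ts : t <= s / (K + 1) by rewrite /t ge_min lexx orbT.
  have med : 0 < Num.min e d by rewrite lt_min e0.
  have te : t < e.
    have : Num.min e d <= e by rewrite ge_min lexx.
    by lra.
  have td : t <= d.
    have : Num.min e d <= d by rewrite ge_min lexx orbT.
    by lra.
  have tt : `|t| = t by rewrite ger0_norm// ltW.
  have := H m.+1 t; rewrite tt F0 ?tt// => /(_ td).
  rewrite big_ord_recr/= big1 => [|i _]; last by rewrite IH ?mul0r.
  rewrite !add0r cmodN cmodM cmodX cmod_real tt expr_div_n.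
  have -> : M * (t ^+ m.+1 / d ^+ m.+1) = K * t * t ^+ m.
    by rewrite /K [t ^+ m.+1]exprS; ring.
  rewrite ler_pM2r ?exprn_gt0// => /le_trans; apply.
  rewrite (le_trans (ler_wpM2l K0 ts))// mulrCA ler_piMr ?(ltW s0)//.
  by rewrite ler_pdivrMr// mul1r lerDl.
move=> t td; apply: cmod_le_small => s s0.
pose r := `|t| / d; have r0 : 0 <= r by rewrite divr_ge0// ltW.
have r1 : `|r| < 1 by rewrite ger0_norm// ltr_pdivrMr// mul1r.
have s1 : 0 < s / (M + 1) by rewrite divr_gt0// ltr_wpDl.
have /cvgrPdist_le/(_ _ s1)[n _ /(_ n (leqnn n))] := cvg_expr r1.
rewrite /= sub0r normrN normrX => Hn.
have := H n t (ltW td); rewrite big1 ?subr0 => [|i _]; last by rewrite c0 mul0r.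
move=> /le_trans; apply; rewrite -/r -(ger0_norm r0).
rewrite (le_trans (ler_wpM2l M0 Hn))// mulrCA ler_piMr ?(ltW s0)//.
by rewrite ler_pdivrMr ?mul1r ?lerDl// ltr_wpDl.
Qed.

End Taylor.

(** * Propagation of zeros to a half-line *)

Section Continuation.
Variable R : realType.

(** The radius is the same at every centre, so each re-expansion extends the zero interval by the
    fixed length [d / 2]. *)
Lemma taylor_continuation (F : R -> R[i]) (d a b : R) : 0 < d -> a < b ->
  (forall x, has_taylor (fun t => F (x + t)) d) ->
  (forall x, a < x < b -> F x = 0) -> forall x, a < x -> F x = 0.
Proof.
move=> d0 ab HF F0.
have step : forall n : nat, forall x, a < x < b + n%:R * (d / 2) -> F x = 0.
  elim=> [|n IH] x; first by rewrite mul0r addr0; exact: F0.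
  set b' := b + n%:R * (d / 2) in IH *.
  have -> : b + n.+1%:R * (d / 2) = b' + d / 2 by rewrite -natr1 /b'; ring.
  have ab' : a < b' by rewrite (lt_le_trans ab)// lerDl mulr_ge0// divr_ge0// ltW.
  move=> /andP[ax xb]; have [xb'|bx'] := ltP x b'; first by rewrite IH ?ax.
  (* The centre lies inside the known zero interval, within [d / 4] of its right end, so that radius
     [d] reaches past [b' + d / 2]. *)
  pose c := Num.max ((a + b') / 2) (b' - d / 4).
  have c1 : (a + b') / 2 <= c by rewrite le_max lexx.
  have c2 : b' - d / 4 <= c by rewrite le_max lexx orbT.
  have cb : c < b' by rewrite gt_max; apply/andP; split; lra.
  pose e := Num.min (c - a) (b' - c).
  have e1 : e <= c - a by rewrite ge_min lexx.
  have e2 : e <= b' - c by rewrite ge_min lexx orbT.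
  have e0 : 0 < e by rewrite lt_min; apply/andP; split; lra.
  rewrite -(subrKC c x); apply: (has_taylor_eq0 d0 e0 (HF c)).
    by move=> t; rewrite ltr_norml => /andP[t1 t2]; apply: IH; apply/andP; split; lra.
  by rewrite ltr_norml; apply/andP; split; lra.
move=> x ax; have d2 : 0 < d / 2 by rewrite divr_gt0.
have [n nx] : exists n : nat, (x - b) / (d / 2) < n%:R.
  exists (Num.bound `|(x - b) / (d / 2)|).
  by rewrite (le_lt_trans (ler_norm _))// archi_boundP.
by apply: (step n); rewrite ax -ltrBlDl -ltr_pdivrMr.
Qed.

End Continuation.

(** * Absolutely convergent trigonometric sums at infinity *)

Section AlmostPeriodic.
Variables (R : realType) (I : choiceType) (al : I -> R).

Definition trig_sum (b : I -> R[i]) (h : R -> R[i]) : Prop :=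
  forall x, is_sum (fun p => b p * cis (al p * x)) (h x).

Lemma abs_bounded_cis (b : I -> R[i]) K x : abs_bounded b K ->
  abs_bounded (fun p => b p * cis (al p * x)) K.
Proof. by apply: abs_bounded_le => p; rewrite cmodM cmod_cis mulr1. Qed.

(** Averaging [h x] with [cis (- (u * al q)) * h (x + u)] multiplies the coefficient at [p] by
    [(1 + cis (u (al p - al q))) / 2]. This factor has modulus at most 1 and equals 1 at [q]; one
    average is made for each frequency to be removed. *)
Lemma trig_sum_sieve (q : I) (L : seq I) b h e T :
  trig_sum b h -> (forall x, T <= x -> cmod (h x) <= e) ->
  exists b' h' T', [/\ trig_sum b' h', forall x, T' <= x -> cmod (h' x) <= e,
    forall p, cmod (b' p) <= cmod (b p), b' q = b q &
    forall r, r \in L -> al r != al q -> b' r = 0].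
Proof.
move=> bh hT; elim: L => [|r L [b' [h' [T' [bh' hT' bb' bq' bL']]]]].
  by exists b, h, T; split.
have [rq|rq] := eqVneq (al r) (al q).
  exists b', h', T'; split => // p; rewrite inE => /predU1P[->|/bL']//.
  by rewrite rq eqxx.
(* This shift makes [cis (u * (al r - al q)) = -1], so the factor at [r] is 0. *)
pose u := pi / (al r - al q).
have cis1 p : cis (u * (al p - al q)) = cis (- (u * al q)) * cis (al p * u).
  by rewrite -cisD; congr cis; ring.
exists (fun p => b' p * (2^-1 * (1 + cis (u * (al p - al q))))),
  (fun x => 2^-1 * (h' x + cis (- (u * al q)) * h' (x + u))),
  (Num.max T' (T' - u)).
have half : cmod (2^-1 : R[i]) = 2^-1.
  have -> : (2^-1 : R[i]) = (2^-1 : R)%:C by rewrite fmorphV rmorph_nat.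
  by rewrite cmod_real ger0_norm.
split.
- move=> x; have := is_sumZ 2^-1 (is_sumD (bh' x)
    (is_sumZ (cis (- (u * al q))) (bh' (x + u)))).
  by congr is_sum; apply/funext => p; rewrite cis1 [al p * (x + u)]mulrDr cisD; ring.
- move=> x; rewrite ge_max => /andP[x1 x2]; rewrite cmodM half.
  have H1 := hT' _ x1.
  have H2 : cmod (h' (x + u)) <= e by apply: hT'; lra.
  have := cmodD (h' x) (cis (- (u * al q)) * h' (x + u)).
  by rewrite cmodM cmod_cis mul1r; lra.
- move=> p; rewrite !cmodM half (le_trans _ (bb' p))// ler_piMr ?cmod_ge0//.
  by have := cmodD 1 (cis (u * (al p - al q))); rewrite cmod1 cmod_cis; lra.
- by rewrite subrr mulr0 cis0 -[1 + 1]/(2%:R) mulVf ?mulr1 ?pnatr_eq0.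
- move=> p; rewrite inE => /predU1P[-> _|pL pq]; last by rewrite bL'// mul0r.
  by rewrite /u divfK ?subr_eq0// cis_pi subrr !mulr0.
Qed.

(* The sieved sum retains the coefficient [b q] while the part of it carried by
   any prescribed finite set of other exponents vanishes, so up to the tail of
   the series [h] cannot be smaller than [b q]. *)
Lemma trig_sum_vanish_at_infty b h K q : abs_bounded b K -> trig_sum b h ->
  (forall e : R, 0 < e -> exists T, forall x, T <= x -> cmod (h x) <= e) ->
  (forall r, b r != 0 -> al r = al q -> r = q) -> b q = 0.
Proof.
move=> bK bh h0 bq; apply: cmod_le_small => e e0.
have e2 : 0 < e / 2 by rewrite divr_gt0.
have [A HA] := abs_bounded_tail bK e2; have [T hT] := h0 _ e2.
have [b' [h' [T' [bh' hT' bb' bq' bA]]]] := trig_sum_sieve q A bh hT.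
have b'A r : r \in A -> r != q -> b' r = 0.
  move=> rA rq; have [br0|br] := eqVneq (b r) 0.
    apply/eqP; rewrite -cmod_eq0 eq_le cmod_ge0 andbT.
    by rewrite (le_trans (bb' r))// br0 cmod0.
  by apply: bA => //; apply: contra rq => /eqP/(bq _ br) ->.
have H : cmod (h' T' - b' q * cis (al q * T')) <= e / 2.
  apply: (is_sum_cmodB_le (A := (q |` A)%fset) (bh' T')) => B.
  rewrite fsubUset fsub1set => /andP[qB AB].
  rewrite (big_fsetD1 q)//= addrAC subrr add0r.
  apply: le_trans (cmod_sum _ _ _) (le_trans _ (HA B AB)).
  rewrite [leRHS]big_mkcond/= (big_fsetD1 q qB)/= ler_wpDl//.
    by case: ifP => // _; exact: cmod_ge0.
  rewrite big_seq [leRHS]big_seq; apply: ler_sum => r; rewrite !inE => /andP[rq _].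
  rewrite cmodM cmod_cis mulr1; case: ifPn => [_|]; first exact: bb'.
  by rewrite negbK => rA; rewrite b'A// cmod0.
rewrite bq' in H; have H' := hT' T' (lexx _).
have := cmodB (h' T') (h' T' - b q * cis (al q * T')).
by rewrite opprB subrKC cmodM cmod_cis mulr1; lra.
Qed.

End AlmostPeriodic.

(** * Polynomials in [w] with trigonometric sums as coefficients *)

Section ExponentialPolynomials.
Variables (R : realType) (I : choiceType) (al : I -> R) (b : nat -> I -> R[i]).
Variables (d s : R) (K : nat -> R).
Hypothesis d0 : 0 < d.
Hypothesis bK : forall k,
  abs_bounded (fun p => b k p * (expR (`|al p| * d))%:C) (K k).
Hypothesis b_inj : forall k p q,
  b k p != 0 -> b k q != 0 -> al p = al q -> p = q.

Let w (x : R) : R[i] := s%:C + 'i * x%:C.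

Lemma abs_bounded_coeff k : abs_bounded (b k) (K k).
Proof.
apply: abs_bounded_le (bK k) => p.
rewrite cmodM cmod_real ger0_norm ?expR_ge0// ler_peMr ?cmod_ge0//.
by rewrite -expR0 ler_expR mulr_ge0// ltW.
Qed.

(** The weight [expR (|al p| d)] in [bK] is the constant of [cis_taylor], and translating by [x]
    only rotates the coefficients; hence one radius for all [x]. *)
Lemma trig_sum_has_taylor k h x : trig_sum al (b k) h ->
  has_taylor (fun t => h (x + t)) d.
Proof.
move=> bh; pose u p := b k p * cis (al p * x).
apply: (@has_taylor_is_sum _ _ (fun p t => u p * cis (al p * t))
  (fun p => cmod (u p) * expR (`|al p| * d))
  (fun p m => u p * (('i * (al p)%:C) ^+ m / m`!%:R)) _ _ (K k)) => //.
- move=> p n t td; under eq_bigr do rewrite -mulrA.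
  rewrite -mulr_sumr -mulrBr cmodM -mulrA ler_wpM2l ?cmod_ge0//.
  exact: cis_taylor.
- move=> A; apply: le_trans (bK k A); apply: ler_sum => p _.
  by rewrite /u !cmodM cmod_cis mulr1 cmod_real (ger0_norm (expR_ge0 _)).
- move=> t; have := bh (x + t); congr is_sum; apply/funext => p.
  by rewrite mulrDr cisD mulrA.
Qed.

(** Solving the relation for its top term and dividing by [w ^ n] gives [|w| |h n| <= C], while
    [|w x| >= x]. *)
Lemma top_coeff_vanish_at_infty n (h : nat -> R -> R[i]) x0 :
  (forall k x, cmod (h k x) <= K k) ->
  (forall x, x0 < x -> \sum_(k < n.+1) w x ^+ k * h k x = 0) ->
  forall e : R, 0 < e -> exists T, forall x, T <= x -> cmod (h n x) <= e.
Proof.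
move=> hK h0 e e0; pose C := \sum_(k < n) K k.
have K0 k : 0 <= K k by apply: le_trans (hK k 0); exact: cmod_ge0.
have C0 : 0 <= C by apply: sumr_ge0.
(* The bound 1 lets [|w|^n] dominate the lower powers, [x0 + 1] keeps [x] where the relation holds,
   and [C / e] yields the final estimate. *)
exists (Num.max (Num.max 1 (x0 + 1)) (C / e)) => x.
rewrite !ge_max => /andP[/andP[x1 xx0] xC].
have wx : x <= cmod (w x).
  have -> : w x = s +i* x by rewrite /w; simpc.
  by rewrite (le_trans _ (ler_Im_cmod _))//= ler_norm.
have w1 : 1 <= cmod (w x) by apply: le_trans wx.
have w0 : 0 < cmod (w x) by apply: lt_le_trans w1.
have H : cmod (w x) ^+ n.+1 * cmod (h n x) <= cmod (w x) ^+ n * C.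
  have -> : cmod (w x) ^+ n.+1 * cmod (h n x) =
      cmod (w x) * cmod (\sum_(k < n) w x ^+ k * h k x).
    have : \sum_(k < n.+1) w x ^+ k * h k x = 0 by apply: h0; lra.
    rewrite big_ord_recr/= => /eqP; rewrite addr_eq0 => /eqP ->.
    by rewrite cmodN cmodM cmodX exprS mulrA.
  rewrite (le_trans (ler_wpM2l (ltW w0) (cmod_sum _ _ _)))//.
  rewrite mulr_sumr mulr_sumr; apply: ler_sum => k _.
  rewrite cmodM cmodX mulrA -exprS ler_pM ?exprn_ge0 ?cmod_ge0//.
  by rewrite ler_weXn2l.
rewrite exprS mulrAC [leRHS]mulrC ler_pM2r ?exprn_gt0// in H.
have x0' : 0 < x by lra.
rewrite -(ler_pM2l x0'); apply: (@le_trans _ _ C).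
  by apply: le_trans H; rewrite ler_wpM2r ?cmod_ge0.
by rewrite -ler_pdivrMr.
Qed.

Lemma exp_poly_eq0 n x0 y0 : x0 < y0 ->
  (forall x, x0 < x < y0 ->
     is_sum (fun p => \sum_(k < n) b k p * cis (al p * x) * w x ^+ k) 0) ->
  forall k p, (k < n)%N -> b k p = 0.
Proof.
move=> xy b0.
have /choice[h' Hh] : forall kx : nat * R,
    exists l, is_sum (fun p => b kx.1 p * cis (al p * kx.2)) l.
  move=> [k x]; apply: is_sum_exists.
  exact: abs_bounded_cis (@abs_bounded_coeff k).
pose h k x := h' (k, x).
have {Hh}bh k : trig_sum al (b k) (h k) by move=> x; exact: (Hh (k, x)).
have hK k x : cmod (h k x) <= K k.
  by apply: is_sum_cmod_le (bh k x) _; apply: abs_bounded_cis; exact: abs_bounded_coeff.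
pose F x := \sum_(k < n) w x ^+ k * h k x.
have HF x : has_taylor (fun t => F (x + t)) d.
  apply: (@has_taylor_sum _ _ (fun k t => w (x + t) ^+ k * h k (x + t))) => k _.
  have wE t : w (x + t) = w x + 'i * t%:C by rewrite /w rmorphD mulrDr addrA.
  under eq_fun do rewrite wE.
  by apply: has_taylor_mul_affineX => //; exact: trig_sum_has_taylor.
have F0 : forall x, x0 < x -> F x = 0.
  apply: (taylor_continuation d0 xy HF) => x /b0; apply: is_sum_inj.
  have := @is_sum_sum _ _ n (fun k p => w x ^+ k * (b k p * cis (al p * x)))
    (fun k => w x ^+ k * h k x) (fun k _ => is_sumZ _ (bh k x)).
  congr is_sum; apply/funext => p; apply: eq_bigr => k _.
  by rewrite mulrC.
(* The descent retains only the vanishing on the half-line: once [b n = 0], the top term drops out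
   of that relation. *)
move: F0; rewrite /F; elim: n {b0 F HF} => [//|n IH] F0.
have bn p : b n p = 0.
  have [//|bp] := eqVneq (b n p) 0.
  apply: (trig_sum_vanish_at_infty (@abs_bounded_coeff n) (bh n)).
    exact: top_coeff_vanish_at_infty hK F0.
  by move=> q bq; exact: b_inj bq bp.
move=> k p; rewrite ltnS leq_eqVlt => /predU1P[->//|]; apply: IH => x /F0.
rewrite big_ord_recr/= (_ : h n x = 0) ?mulr0 ?addr0//.
apply: is_sum_inj (bh n x) _; under eq_fun do rewrite bn mul0r.
exact: is_sum0.
Qed.

End ExponentialPolynomials.

(** * Polar coordinates, logarithm and powers *)

Section Logarithm.
Variable R : realType.
Implicit Types (s x : R) (z w : R[i]).

(** If [x < y], the half difference [u] lies strictly between 0 and [pi], so [sin u] is nonzero,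
    contradicting [1 = cos (2 u) = 1 - 2 sin^2 u]. *)
Lemma cis_inj x y : 0 <= x < 2 * pi -> 0 <= y < 2 * pi ->
  cis x = cis y -> x = y.
Proof.
wlog xy : x y / x <= y => [H x2 y2 e|].
  by have /orP[/H|/H] := le_total x y; [apply|move=> /(_ y2 x2 (esym e))].
move=> /andP[x0 x2] /andP[y0 y2] [cxy sxy].
apply/eqP; rewrite eq_le xy/= leNgt; apply/negP => lt_xy.
pose u := (y - x) / 2.
have : sin u != 0.
  by rewrite gt_eqF// sin_gt0_pi// /u; apply/andP; split; lra.
have : cos (y - x) = 1 by rewrite cosB cxy sxy -!expr2 cos2Dsin2.
have -> : y - x = u *+ 2 by rewrite /u -mulr_natr divfK ?pnatr_eq0.
rewrite cos_mulr2n cos2sin2 mulr2n => H.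
have : sin u ^+ 2 = 0 by lra.
by move/eqP; rewrite expf_eq0/= => ->.
Qed.

Lemma polar_form z : z != 0 ->
  exists s x, 0 <= x < 2 * pi /\ z = (expR s)%:C * cis x.
Proof.
move=> z0; have r0 : 0 < cmod z by rewrite lt_neqAle cmod_ge0 eq_sym cmod_eq0 z0.
exists (ln (cmod z)); rewrite lnK ?posrE//.
case: z z0 r0 => a b z0; set r := cmod _ => r0.
have rab : (a / r) ^+ 2 + (b / r) ^+ 2 = 1.
  rewrite !expr_div_n -mulrDl sqr_sqrtr ?addr_ge0 ?sqr_ge0//.
  rewrite divff// gt_eqF// -[a ^+ 2 + _]sqr_sqrtr ?addr_ge0 ?sqr_ge0//.
  by rewrite exprn_gt0.
have a1 : -1 <= a / r <= 1.
  rewrite -ler_norml -(@ler_pXn2r _ 2) ?nnegrE// expr1n real_normK ?num_real//.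
  by have := sqr_ge0 (b / r); lra.
have rb : `|b / r| = Num.sqrt (1 - (a / r) ^+ 2).
  by rewrite -rab addrAC subrr add0r sqrtr_sqr.
have A0 := acos_ge0 a1; have A1 := acos_lepi a1; have p0 := pi_gt0 R.
have E x : cos x = a / r -> sin x = b / r -> a +i* b = r%:C * cis x.
  move=> cx sx; rewrite /cis cx sx; simpc.
  by rewrite ![r * _]mulrC !divfK ?gt_eqF.
have [b0|b0] := leP 0 (b / r).
  exists (acos (a / r)); split; first by rewrite A0/=; lra.
  by apply: E; rewrite ?acosK// sin_acos// -rb ger0_norm.
(* In the lower half-plane the angle is [2 * pi - acos (a / r)]; it is below [2 * pi] only because
   [acos (a / r)] is nonzero. *)
have an1 : a / r != 1.
  apply/negP => /eqP ar; move: rab; rewrite ar expr1n => br.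
  have : (b / r) ^+ 2 = 0 by lra.
  by move/eqP; rewrite expf_eq0/= lt_eqF.
have A2 : 0 < acos (a / r).
  by apply: acos_gt0; case/andP: a1 => -> /=; rewrite lt_neqAle an1.
exists (2 * pi - acos (a / r)); split; first by apply/andP; split; lra.
rewrite mulr_natl addrC; apply: E; rewrite ?cosD2pi ?sinD2pi ?cosN ?sinN ?acosK//.
by rewrite sin_acos// -rb ltr0_norm ?opprK.
Qed.

Lemma clog_polar s x : 0 <= x < 2 * pi -> clog ((expR s)%:C * cis x) = s +i* x.
Proof.
move=> x2; have Hr : cmod ((expR s)%:C * cis x) = expR s.
  by rewrite cmodM cmod_cis mulr1 cmod_real ger0_norm ?expR_ge0.
rewrite /clog Hr expRK; congr (_ +i* _); rewrite /carg Hr.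
have [|y2 e] := @getPex _ [set t : R | 0 <= t < 2 * pi /\
  (expR s)%:C * cis x = (expR s)%:C * cis t]; first by exists x.
apply: cis_inj => //; apply: (mulfI _ (esym e)).
by rewrite -cmod_eq0 cmod_real normr_eq0 gt_eqF ?expR_gt0.
Qed.

Lemma cexp_complex s x : cexp (s +i* x) = (expR s)%:C * cis x.
Proof. by []. Qed.

Lemma cexpD z w : cexp (z + w) = cexp z * cexp w.
Proof.
case: z w => [a b] [c d].
rewrite -[(_ +i* _) + _]/((a + c) +i* (b + d)) !cexp_complex expRD cisD rmorphM.
by rewrite mulrACA.
Qed.

Lemma cexpMn z n : cexp (n%:R * z) = cexp z ^+ n.
Proof.
elim: n => [|n IH]; last by rewrite -natr1 mulrDl mul1r cexpD IH exprSr.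
by rewrite mul0r -[0]/(0 +i* 0) cexp_complex expR0 cis0 mulr1.
Qed.

Lemma cexp_clog z : z != 0 -> cexp (clog z) = z.
Proof. by move=> /polar_form[s [x [x2 ->]]]; rewrite clog_polar. Qed.

Lemma cpow_nat z n : z != 0 -> cpow z n%:R = z ^+ n.
Proof. by move=> z0; rewrite /cpow (negbTE z0) cexpMn cexp_clog. Qed.

(** The strict bound [0 < x] keeps [clog z] nonzero, so that its [cpow] to the exponent [n] is an
    ordinary power. *)
Lemma expansion_term_polar (a : R[i] * R[i] -> R[i]) s x (r : R) n :
  0 < x < 2 * pi ->
  expansion_term a ((expR s)%:C * cis x) (r%:C, n%:R) =
  a (r%:C, n%:R) * (expR (r * s))%:C * cis (r * x) * (s%:C + 'i * x%:C) ^+ n.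
Proof.
move=> /andP[x0 x2].
have wE : s +i* x = s%:C + 'i * x%:C by simpc.
rewrite /expansion_term/= clog_polar ?ltW//= cpow_nat; last first.
  by rewrite eq_complex/= negb_and (gt_eqF x0) orbT.
rewrite /cpow mulf_eq0 -!cmod_eq0 cmod_cis oner_eq0 cmod_real normr_eq0.
rewrite (gt_eqF (expR_gt0 s))/= clog_polar ?ltW//= wE; congr (_ * _).
by rewrite -mulrA -cexp_complex -wE; congr (_ * cexp _); simpc.
Qed.

End Logarithm.

(** * From the library notion of convergence to [is_sum] *)

Lemma abs_converges_is_sum (R : realType) (I : choiceType) (S : set I)
    (f : I -> R[i]) (l : R[i]) : abs_converges_to S f l ->
  let g i := if i \in S then f i else 0 in
  is_sum g l /\ exists K, abs_bounded g K.
Proof.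
move=> [fS fl] g; split.
  move=> e e0; have e1 : 0 < e%:C by rewrite ltcR.
  have [A _ HA] := fl _ (nbhsx_ballx (l : R[i]^o) _ e1); exists A => B AB.
  have := HA B AB; rewrite /= /partial_sum /ball/= -cmod_norm ltcR.
  by rewrite big_seq_fsetE/= -opprB cmodN => /ltW.
exists (fine (\esum_(i in S) `|(cmod (f i))%:E|)%E) => A.
have -> : \sum_(i <- A) cmod (g i) = \sum_(i <- A | i \in S) cmod (f i).
  rewrite [RHS]big_mkcond; apply: eq_bigr => i _; rewrite /g; case: ifP => // _.
  exact: cmod0.
rewrite -lee_fin fineK; last by rewrite -summableE.
apply: esum_ge; exists [set i | i \in [fset i in A | i \in S]%fset].
  split; first exact: finite_fset.
  by move=> i /=; rewrite !inE/= => /andP[_]; rewrite inE.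
rewrite -fsbig_seq//= big_fset_condE -sumEFin.
by apply: lee_sum => i _; rewrite lee_fin ler_norm.
Qed.

(** * Polar rectangles inside open sets *)

Section PolarNeighbourhood.
Variable R : realType.

Lemma open_polar (U : set R[i]^o) (s0 x0 : R) : open U ->
  U ((expR s0)%:C * cis x0) ->
  exists2 d : R, 0 < d & forall s x, `|s - s0| <= d -> `|x - x0| <= d ->
    U ((expR s)%:C * cis x).
Proof.
move=> oU Uz.
have /nbhs_ballP[e /= e0 He] := open_nbhs_nbhs (conj oU Uz).
(* The radius of a ball in [R[i]] is a complex number; its positivity forces the imaginary part to
   be 0. *)
case: e e0 He => [e e']; rewrite ltcE /= => /andP[/eqP -> {e'} e0] He.
have e3 : 0 < e / 3 by rewrite divr_gt0.
have E0 : 0 < expR s0 by exact: expR_gt0.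
(* Change of modulus, cosine and sine each receive a third of [e]; the last two are later multiplied
   by [expR s0]. *)
have e4 : 0 < e / 3 / expR s0 by rewrite divr_gt0.
have /cvgrPdist_lt/(_ _ e3)/nbhs_ballP[d1 /= d10 H1] := @continuous_expR R s0.
have /cvgrPdist_lt/(_ _ e4)/nbhs_ballP[d2 /= d20 H2] := @continuous_cos R x0.
have /cvgrPdist_lt/(_ _ e4)/nbhs_ballP[d3 /= d30 H3] := @continuous_sin R x0.
pose d := Num.min d1 (Num.min d2 d3); exists (d / 2).
  by rewrite divr_gt0// !lt_min d10 d20.
move=> s x sd xd; apply: He; rewrite /ball /= -cmod_norm.
have dd : d / 2 < d by rewrite ltr_pdivrMr// ltr_pMr ?ltr1n// !lt_min d10 d20.
have D1 : d <= d1 by rewrite ge_min lexx.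
have D2 : d <= d2 by rewrite !ge_min lexx orbT.
have D3 : d <= d3 by rewrite !ge_min lexx !orbT.
have {}H1 : `|expR s0 - expR s| < e / 3.
  by apply: H1; rewrite /ball/= distrC; lra.
have {}H2 : `|cos x0 - cos x| < e / 3 / expR s0.
  by apply: H2; rewrite /ball/= distrC; lra.
have {}H3 : `|sin x0 - sin x| < e / 3 / expR s0.
  by apply: H3; rewrite /ball/= distrC; lra.
have -> : (expR s0)%:C * cis x0 - (expR s)%:C * cis x =
    (expR s0 - expR s)%:C * cis x + (expR s0)%:C * (cis x0 - cis x).
  by rewrite rmorphB; ring.
rewrite ltcR (le_lt_trans (cmodD _ _))// !cmodM cmod_cis mulr1 !cmod_real.
rewrite (ger0_norm (ltW E0)).
have H4 : cmod (cis x0 - cis x) < 2 * (e / 3 / expR s0).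
  have -> : cis x0 - cis x = (cos x0 - cos x) +i* (sin x0 - sin x) by [].
  by rewrite (le_lt_trans (cmod_le_ReIm _ _))//; lra.
have : expR s0 * cmod (cis x0 - cis x) < 2 * (e / 3).
  rewrite -ltr_pdivlMl// (lt_le_trans H4)//.
  by rewrite [leRHS]mulrC mulrA.
lra.
Qed.

End PolarNeighbourhood.

(** * Reduction of expansions to exponential polynomials *)

Lemma unique_expansion_reals_nats (R : realType) (N : nat) (D : set R) :
  unique_expansion_set (complex_reals D `*` complex_nats_upto N).
Proof.
set S := _ `*` _ => a [U [oU [z0 Uz0] U0 HU]].
have [s0 [x0 [/andP[x00 x02] z0E]]] := polar_form (U0 _ Uz0).
rewrite z0E in Uz0; have [d d0 Hd] := open_polar oU Uz0.
(* Capping at [2 * pi] keeps the angles of the open interval from [x0] to [y0] within the chosen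
   branch of the logarithm. *)
pose y0 := Num.min (x0 + d) (2 * pi).
have xy : x0 < y0 by rewrite lt_min x02 ltrDl d0.
have yd : y0 <= x0 + d by rewrite ge_min lexx.
have ypi : y0 <= 2 * pi by rewrite ge_min lexx orbT.
pose al (p : R[i] * R[i]) := complex.Re p.1.
(* Terms are sorted by their power [k] of the logarithm, and the modulus factor of [z] is absorbed
   into the coefficient. *)
pose b s k (p : R[i] * R[i]) :=
  if (p \in S) && (p.2 == k%:R) then a p * (expR (al p * s))%:C else 0.
pose w s x : R[i] := s%:C + 'i * x%:C.
pose g s x p :=
  if p \in S then expansion_term a ((expR s)%:C * cis x) p else 0.
have SP p : p \in S -> exists r n, p = (r%:C, n%:R) /\ (n <= N)%N.
  rewrite inE => -[[r _ rE] [n nN nE]]; exists r, n; split => //.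
  by rewrite rE nE; case: (p).
have HS s x : `|s - s0| <= d -> x0 < x < y0 ->
    is_sum (g s x) 0 /\ exists K, abs_bounded (g s x) K.
  move=> sd /andP[x1 x2]; apply: abs_converges_is_sum; apply: HU.
  by apply: Hd => //; rewrite ler_norml; apply/andP; split; lra.
have natI (m n : nat) : (m%:R == n%:R :> R[i]) = (m == n) by rewrite eqr_nat.
have gE s x p : x0 < x < y0 ->
    g s x p = \sum_(k < N.+1) b s k p * cis (al p * x) * w s x ^+ k.
  move=> /andP[x1 x2]; rewrite /g /b; case: ifPn => [pS|_]; last first.
    by rewrite big1// => k _; rewrite !mul0r.
  have [r [n [-> nN]]] := SP _ pS.
  rewrite expansion_term_polar; last by apply/andP; split; lra.
  rewrite (bigD1 (Ordinal (nN : (n < N.+1)%N)))//= natI eqxx big1 ?addr0//.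
  move=> k kn; rewrite natI (_ : (n == k) = false) ?mul0r//.
  by apply/negbTE; apply: contra kn => /eqP nk; apply/eqP/val_inj.
pose x1 := (x0 + y0) / 2.
have x1y : x0 < x1 < y0 by rewrite /x1; apply/andP; split; lra.
have w0 s x : 0 < x -> 0 < cmod (w s x).
  move=> xx; have -> : w s x = s +i* x by rewrite /w; simpc.
  by rewrite (lt_le_trans _ (ler_Im_cmod _))//= normr_gt0 gt_eqF.
(* Absolute convergence at the single angle [x1] suffices: there [|w|] is positive and can be
   divided out. *)
have bK s : `|s - s0| <= d -> exists K, forall k, abs_bounded (b s k) (K k).
  move=> sd; have [_ [K HK]] := HS s x1 sd x1y.
  have ws : 0 < cmod (w s x1) by apply: w0; case/andP: x1y; lra.
  exists (fun k => K / cmod (w s x1) ^+ k) => k A.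
  rewrite ler_pdivlMr ?exprn_gt0// mulr_suml; apply: le_trans (HK A).
  apply: ler_sum => p _; rewrite /b; case: ifPn => [/andP[pS pk]|_]; last first.
    by rewrite cmod0 mul0r cmod_ge0.
  rewrite /g pS; have [r [n [pE nN]]] := SP _ pS.
  rewrite pE expansion_term_polar; last by case/andP: x1y => *; apply/andP; split; lra.
  move: pk; rewrite pE natI => /eqP ->.
  by rewrite !cmodM cmod_cis mulr1 cmodX.
(* The bounds at [s0 + d] and [s0 - d] together control the weighted sum, as [expR (|al p| d)] is at
   most [expR (al p * d) + expR (- al p * d)]. *)
have [|Kp HKp] := bK (s0 + d); first by rewrite addrAC subrr add0r ger0_norm// ltW.
have [|Km HKm] := bK (s0 - d).
  by rewrite addrAC subrr add0r normrN ger0_norm// ltW.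
have b0 : forall k p, (k < N.+1)%N -> b s0 k p = 0.
  apply: (@exp_poly_eq0 _ _ al (b s0) d s0 (fun k => Kp k + Km k) d0 _ _ _ x0 y0) => //.
  - move=> k A; apply: le_trans (lerD (HKp k A) (HKm k A)).
    rewrite -big_split/=; apply: ler_sum => p _; rewrite /b.
    case: ifP => _; last by rewrite mul0r cmod0 addr0.
    rewrite !cmodM -mulrA -mulrDr ler_wpM2l ?cmod_ge0// !cmod_real.
    rewrite !(ger0_norm (expR_ge0 _)) -expRD.
    have [ap|ap] := ger0P (al p).
      rewrite -mulrDr; apply: ler_wpDr; first exact: expR_ge0.
      by rewrite ler_expR.
    apply: ler_wpDl; first exact: expR_ge0.
    by rewrite ler_expR mulrBr mulNr.
  (* For fixed [k] a nonzero coefficient has second index [k], so the real exponent alone determines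
     [p]. *)
  - move=> k p q; rewrite /b; case: ifPn => [/andP[pS pk] _|]; last by rewrite eqxx.
    case: ifPn => [/andP[qS qk] _|]; last by rewrite eqxx.
    move: pk qk; have [r [n [-> _]]] := SP _ pS; have [r' [n' [-> _]]] := SP _ qS.
    by rewrite /al/= => /eqP -> /eqP -> ->.
  - move=> x xx; have [|+ _] := HS s0 x _ xx.
      by rewrite subrr normr0 ltW.
    by congr is_sum; apply/funext => p; exact: gE.
move=> p; rewrite -in_setE => pS; have [r [n [pE nN]]] := SP _ pS.
have := b0 n p nN; rewrite /b pS pE /= eqxx => /eqP.
rewrite mulf_eq0 -[X in _ || X]cmod_eq0 cmod_real normr_eq0.
by rewrite (gt_eqF (expR_gt0 _)) orbF => /eqP.
Qed.

Theorem proposition7p8 (R : realType) (N : nat) :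
  unique_expansion_set
    (complex_reals [set: R] `*` complex_nats_upto N) /\
  forall D : set R,
    unique_expansion_set (complex_reals D `*` complex_nats_upto N).
Proof. by split=> [|D]; exact: unique_expansion_reals_nats. Qed.
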